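(* Let $p$ be an odd prime, let $q:=p^m$ (with $m\ge 1$), and let $G$ be a finite $p$-group of $\mathbb F_q$-Heisenberg type of rank $n$. Write $V:=G/Z(G)\cong\mathbb F_q^{2n}$, with its symplectic form coming from the commutator. For $0\le k\le n$, let $L_{n,k}(q)$ denote the number of $k$-dimensional totally isotropic $\mathbb F_q$-subspaces of $V$. Then $$L_{n,k}(q)=\prod_{i=0}^{k-1}\frac{q^{2n-2i}-1}{q^{k-i}-1}.$$ For every $r\ge 1$ one has $$I_r^{(q)}(n)=\sum_{k=0}^{\min(n,r)}L_{n,k}(q)\prod_{i=0}^{k-1}(q^r-q^i),$$ and hence $$|\mathrm{Comm}_r(G)|=|Z(G)|^r\sum_{k=0}^{\min(n,r)}L_{n,k}(q)\prod_{i=0}^{k-1}(q^r-q^i),$$ equivalently $$P_r(G)=q^{-2nr}\sum_{k=0}^{\min(n,r)}L_{n,k}(q)\prod_{i=0}^{k-1}(q^r-q^i).$$ In particular, the full hierarchy $\{P_r(G)\}_{r\ge2}$ depends only on $(q,n)$. Now let $q':=p^{m'}$ (with $m'\ge1$), and let $H$ be another finite $p$-group of $\mathbb F_{q'}$-Heisenberg type of rank $n'$. Then the following are equivalent: 1. $G$ and $H$ are isoclinic; 2. $(q,n)=(q',n')$; 3. $P_2(G)=P_2(H)$ and $P_3(G)=P_3(H)$; 4. $P_r(G)=P_r(H)$ for all $r\ge2$. Moreover, in (3) the parameter $q$ is the unique positive root of $$\bigl(P_2(G)-P_3(G)\bigr)X^2+\bigl(P_2(G)-1\bigr)X+\bigl(P_2(G)-1\bigr)=0,$$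 and then $$q^{-2n}=\frac{qP_2(G)-1}{q-1}.$$ Finally, setting $$\mathcal P_G(z):=\sum_{r\ge2}P_r(G)z^{r-2},$$ the series $\mathcal P_G(z)$ is rational and its pole set is contained in $\{q^n,q^{n+1},\dots,q^{2n}\}$. In particular, the pole at $z=q^n$ is present.
   Context: For a finite group $G$ and $r\ge 1$, $\mathrm{Comm}_r(G):=\{(x_1,\dots,x_r)\in G^r : x_ix_j=x_jx_i\ \text{for all } i,j\}$ and $P_r(G):=|\mathrm{Comm}_r(G)|/|G|^r$. $G'$ is the commutator subgroup and $Z(G)$ the center. Empty products equal $1$. Heisenberg type: for an odd prime $p$ and $q=p^m$, a finite $p$-group $G$ is of $\mathbb F_q$-Heisenberg type of rank $n$ if (i) $G$ has nilpotency class $2$ and exponent $p$; (ii) $G'=Z(G)$ is elementary abelian of order $q$ (so $G'\cong\mathbb F_q$ as additive groups); (iii) $V:=G/Z(G)$ carries the structure of an $\mathbb F_q$-vector space of dimension $2n$ such that, under an identification $G'\cong\mathbb F_q$, the commutator map $\beta:V\times V\to\mathbb F_q$, $\beta(xZ(G),yZ(G))=[x,y]$, is a nondegenerate alternating $\mathbb F_q$-bilinear form. For $r\ge1$, $$I_r^{(q)}(n):=\big|\{(v_1,\dots,v_r)\in(\mathbb F_q^{2n})^r:\ \langle v_i,v_j\rangle=0\ \forall i<j\}\big|,$$ where $\langle\cdot,\cdot\rangle$ is any nondegenerate alternating bilinear form on $\mathbb F_q^{2n}$. A subspace $U$ is totally isotropic if the form vanishes on $U\times U$. Two groups $G,H$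 are isoclinic if there exist isomorphisms $\phi:G/Z(G)\to H/Z(H)$ and $\psi:G'\to H'$ (of groups) with $\psi\circ\kappa_G=\kappa_H\circ(\phi\times\phi)$, where $\kappa_G:(G/Z(G))^2\to G'$ is $(gZ(G),hZ(G))\mapsto[g,h]$, and similarly $\kappa_H$. *)

(* Defs.v *)
From HB Require Import structures.
From mathcomp Require Import all_boot all_order all_fingroup all_algebra.
From mathcomp Require Import all_solvable.

Set Implicit Arguments.
Unset Strict Implicit.
Unset Printing Implicit Defensive.

Import GRing.Theory Num.Theory VectorInternalTheory.
Local Open Scope ring_scope.

(* Over a finite field there are finitely many subspaces, so that they can be
   counted with #|_|. *)
HB.instance Definition _ (F : finFieldType) (W : vectType F) :=
  [Countable of {vspace W} by <:].
HB.instance Definition _ (F : finFieldType) (W : vectType F) :=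
  [Finite of {vspace W} by <:].

Section CommutingTuples.
Variables (gT : finGroupType) (G : {group gT}).

Definition comm_tuples (r : nat) : {set {ffun 'I_r -> gT}} :=
  [set x : {ffun 'I_r -> gT} |
    [forall i, x i \in G] &&
    [forall i, [forall j, (x i * x j)%g == (x j * x i)%g]]].

Definition comm_prob (r : nat) : rat :=
  #|comm_tuples r|%:R / #|G|%:R ^+ r.

(* The commutator map (gZ(G), hZ(G)) |-> [g, h] on G / Z(G). It is computed on
   representatives; comm_mapE shows that the choice is immaterial. *)
Definition comm_map (a b : coset_of 'Z(G)) : gT := [~ repr a, repr b]%g.

Lemma comm_mapE (g h : gT) : g \in G -> h \in G ->
  comm_map (coset 'Z(G) g) (coset 'Z(G) h) = [~ g, h]%g.
Proof.
have nZ x : x \in G -> x \in 'N('Z(G))%g.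
  by apply/subsetP; apply: normal_norm; apply: center_normal.
have reprE x : x \in G ->
    exists2 z, z \in 'Z(G)%g & repr (coset 'Z(G) x) = (z * x)%g.
  move=> Gx; have := mem_repr_coset (coset 'Z(G) x).
  by rewrite val_coset ?nZ // => /rcosetP[z Zz ->]; exists z.
move=> Gg Gh; rewrite /comm_map.
have [z Zz ->] := reprE g Gg; have [t Zt ->] := reprE h Gh.
have GZ s : s \in 'Z(G)%g -> s \in G by move=> /centerP[].
have cZl s x : s \in 'Z(G)%g -> x \in G -> [~ s, x]%g = 1%g.
  by move=> /centerP[_ cs] Gx; apply/eqP/commgP; apply: cs.
have cZr s x : s \in 'Z(G)%g -> x \in G -> [~ x, s]%g = 1%g.
  by move=> Zs Gx; apply/eqP/commgP/commute_sym/commgP; rewrite cZl.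
have Gth : (t * h)%g \in G by apply: groupM => //; apply: GZ.
rewrite commMgJ cZl // conj1g mul1g commgMJ (cZr t g) // conj1g.
exact: mulg1.
Qed.

End CommutingTuples.

Definition isoclinic (gT hT : finGroupType) (G : {group gT}) (H : {group hT}) :=
  exists (phi : {morphism (G / 'Z(G))%g >-> coset_of 'Z(H)})
         (psi : {morphism (G^`(1))%g >-> hT}),
    [/\ isom (G / 'Z(G)) (H / 'Z(H)) phi,
        isom G^`(1) H^`(1) psi
      & forall a b, a \in (G / 'Z(G))%g -> b \in (G / 'Z(G))%g ->
          psi (comm_map a b) = comm_map (phi a) (phi b)].

Section Forms.
Variables (F : finFieldType) (d : nat).

Definition alternating_form (B : {biscalar 'rV[F]_d}) := forall u, B u u = 0.

Definition nondegenerate_form (B : {biscalar 'rV[F]_d}) :=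
  forall u, (forall v, B u v = 0) -> u = 0.

Definition isotropic_tuples (B : {biscalar 'rV[F]_d}) (r : nat) :
    {set {ffun 'I_r -> 'rV[F]_d}} :=
  [set v : {ffun 'I_r -> 'rV[F]_d} |
    [forall i : 'I_r, [forall j : 'I_r, (i < j)%N ==> (B (v i) (v j) == 0)]]].

Definition totally_isotropic (B : {biscalar 'rV[F]_d})
    (U : {vspace 'rV[F]_d}) : bool :=
  [forall u in U, [forall v in U, B u v == 0]].

Definition isotropic_subspaces (B : {biscalar 'rV[F]_d}) (k : nat) :
    {set {vspace 'rV[F]_d}} :=
  [set U | (\dim U == k) && totally_isotropic B U].

End Forms.

(* An F-vector space structure of dimension 2n on V = G / Z(G), given as a group
   isomorphism hs_coord from V onto F^(2n) along which the scaling is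
   transported, together with an identification hs_comm of G' with the additive
   group F under which the commutator map becomes the form hs_form. *)
Record heisenberg_structure (F : finFieldType) (n : nat) (gT : finGroupType)
    (G : {group gT}) := HeisenbergStructure {
  hs_coord : coset_of 'Z(G) -> 'rV[F]_(2 * n);
  hs_comm : gT -> F;
  hs_form : {biscalar 'rV[F]_(2 * n)};
  hs_coordM : {in (G / 'Z(G))%g &, {morph hs_coord : a b / (a * b)%g >-> a + b}};
  hs_coord_inj : {in (G / 'Z(G))%g &, injective hs_coord};
  hs_coord_surj : hs_coord @: (G / 'Z(G))%g = [set: 'rV[F]_(2 * n)];
  hs_commM : {in (G^`(1))%g &, {morph hs_comm : x y / (x * y)%g >-> x + y}};
  hs_comm_inj : {in (G^`(1))%g &, injective hs_comm};
  hs_comm_surj : hs_comm @: (G^`(1))%g = [set: F];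
  hs_formE : {in (G / 'Z(G))%g &, forall a b,
    hs_form (hs_coord a) (hs_coord b) = hs_comm (comm_map a b)};
  hs_alternating : alternating_form hs_form;
  hs_nondegenerate : nondegenerate_form hs_form
}.

Definition heisenberg_type (p q n : nat) (gT : finGroupType)
    (G : {group gT}) : Prop :=
  [/\ (p.-group G)%g,
      nil_class G = 2%N /\ exponent G = p,
      (G^`(1))%g = 'Z(G)%g,
      (p.-abelem 'Z(G))%g /\ #|'Z(G)%g| = q
    & exists F : finFieldType,
        #|F| = q /\ inhabited (heisenberg_structure F n G)].

(* The formal power series with coefficients a equals the fraction N / D. *)
Definition series_eq_frac (a : nat -> rat) (N D : {poly rat}) : Prop :=
  D != 0 /\ forall m : nat, \sum_(i < m.+1) D`_i * a (m - i)%N = N`_m.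

Definition rational_series (a : nat -> rat) : Prop :=
  exists N D : {poly rat}, series_eq_frac a N D.

(* A pole is a root of the denominator of the fraction in lowest terms, in an
   algebraically closed field C of complex numbers. *)
Definition series_pole (C : numClosedFieldType) (a : nat -> rat) (z : C) :
    Prop :=
  exists N D : {poly rat},
    [/\ series_eq_frac a N D, coprimep N D & root (map_poly ratr D) z].

(* Main.v *)
From HB Require Import structures.
Require Import Defs.
From mathcomp Require Import all_boot all_order all_fingroup all_algebra.
From mathcomp Require Import all_solvable.
From mathcomp Require Import finfield mxabelem ring lra zify.

Set Implicit Arguments.
Unset Strict Implicit.
Unset Printing Implicit Defensive.

Import Order.TTheory GRing.Theory Num.Theory.
Local Open Scope ring_scope.

(** A tuple [(x_1, ..., x_r)] of elements of [G] commutes exactly when the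
    classes of the [x_i] modulo the center are pairwise orthogonal for the
    commutator form, so that [|Comm_r(G)| = |Z(G)|^r I_r(n)], and everything
    about the probabilities [P_r(G)] is read off the symplectic space [V].

    Counting: an isotropic [r]-tuple amounts to a totally isotropic subspace
    [U] together with a tuple that spans it. If [U] has dimension [k], then the
    spanning [r]-tuples of [U] are the [r]-by-[k] matrices of full column rank,
    in number [\prod_(i < k) (q^r - q^i)] ([card_spanning_matrices]). Summing
    over [U] gives the formula for [I_r(n)]. The number of [U] comes from the
    case [r = k], since isotropic frames can be counted by choosing one vector
    after the other: a vector that has [i] predecessors is taken in their
    orthogonal, a space of dimension [2n - i], and outside of their span, which
    leaves [q^(2n - i) - q^i] choices ([card_isotropic_frames]).

    Recovering [(q, n)]: with [t = q^(- 2n)] one finds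
    [P_2 = (1 + (q - 1) t) / q] and [P_3 = P_2 - (1 - P_2) (q + 1) / q^2]. The
    second relation says that [q] is a root of the quadratic polynomial of the
    statement, whose other root is [- q / (q + 1)]; the first one then gives
    [t], hence [n].

    Isoclinism: isoclinic groups have central quotients of the same order
    [q^(2n)] and derived subgroups of the same order [q]. Conversely, if
    [(q, n)] is the same for both groups, then there is a morphism [f] between
    the two fields ([finField_iso]), and matching symplectic bases gives an
    [f]-semilinear isometry between the two symplectic spaces
    ([semilinear_isometry]). Read through the identifications with [G / Z(G)]
    and [G'], the isometry and [f] form an isoclinism.

    Generating series: for fixed [q] and [n], [I_r(n)] is a polynomial of degree
    [n] in [q^r], so that [P_r] is a combination of the geometric sequences of
    ratios [q^(j - 2n)] with [j <= n]. The pole at [q^(2n - j)] of their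
    generating series survives exactly when the coefficient of the [j]-th
    sequence is nonzero ([exp_series_poleP]). For [j = n] this coefficient is,
    up to a power of [q], the leading coefficient of the polynomial, that is,
    the number of Lagrangian subspaces. *)

(** * Isotropic frames of an alternating matrix *)

Definition alternating_mx (F : fieldType) d (M : 'M[F]_d) :=
  forall w : 'rV_d, w *m M *m w^T = 0.

Lemma alternating_mx_skew (F : fieldType) d (M : 'M[F]_d) :
  alternating_mx M -> M^T = - M.
Proof.
move=> altM; apply/matrixP=> i j; rewrite !mxE.
have E (k l : 'I_d) :
    ((delta_mx 0 k : 'rV_d) *m M *m (delta_mx 0 l : 'rV_d)^T) 0 0 = M k l.
  by rewrite trmx_delta -rowE -colE !mxE.
have := altM (delta_mx 0 i + delta_mx 0 j).
rewrite linearD /= !mulmxDl !mulmxDr !altM add0r addr0.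
move=> /matrixP/(_ 0 0); rewrite mxE !E mxE => /eqP.
by rewrite addrC addr_eq0 => /eqP.
Qed.

Lemma alternating_mx_orthC (F : fieldType) d (M : 'M[F]_d) k l
    (A : 'M_(k, d)) (B : 'M_(l, d)) :
  alternating_mx M -> (A *m M *m B^T == 0) = (B *m M *m A^T == 0).
Proof.
move=> altM; rewrite -[LHS](inj_eq trmx_inj) trmx0 !trmx_mul trmxK.
by rewrite (alternating_mx_skew altM) mulNmx mulmxN oppr_eq0 mulmxA.
Qed.

Lemma card_row_space (F : finFieldType) d k (A : 'M[F]_(k, d)) :
  #|[set w : 'rV_d | (w <= A)%MS]| = (#|F| ^ \rank A)%N.
Proof. by rewrite -card_rowg. Qed.

Lemma row_free_col_mx (F : fieldType) d k (w : 'rV[F]_d) (A : 'M_(k, d)) :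
  row_free (col_mx w A) = row_free A && ~~ (w <= A)%MS.
Proof.
have rE : \rank (col_mx w A) = \rank (w + A)%MS.
  by apply/eqmx_rank/eqmxP/eqmx_sym/addsmxE.
rewrite /row_free rE.
have [wA | wA] := boolP (w <= A)%MS; rewrite ?andbF ?andbT.
  have -> : \rank (w + A)%MS = \rank A.
    by apply/eqmx_rank; rewrite addsmxSr andbT addsmx_sub wA submx_refl.
  by apply/negbTE; rewrite neq_ltn ltnS rank_leq_row.
have wn0 : w != 0 by apply: contraNneq wA => ->; apply: sub0mx.
have dir : (w :&: A = 0)%MS.
  apply/eqP; rewrite -mxrank_eq0 -leqn0 leqNgt; apply: contra wA => r1.
  apply: submx_trans (capmxSr w A).
  rewrite -(geq_leqif (mxrank_leqif_sup (capmxSl w A))).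
  by rewrite (leq_trans (rank_leq_row _)).
by rewrite (mxrank_disjoint_sum dir) rank_rV wn0 add1n eqSS.
Qed.

Section IsotropicFrames.
Variables (F : finFieldType) (d : nat).
Implicit Type M : 'M[F]_d.

Definition isotropic_frames M k : {set 'M[F]_(k, d)} :=
  [set A | row_free A && (A *m M *m A^T == 0)].

(** A frame with one more row is a frame [A] together with a vector of the
    orthogonal of [A] that lies outside the row space of [A]; the latter is
    contained in the former since [A] is isotropic. *)
Lemma card_isotropic_frames_step M k c : alternating_mx M ->
  (forall A, A \in isotropic_frames M k ->
     #|[set w : 'rV_d | w *m M *m A^T == 0]| = c) ->
  #|isotropic_frames M k.+1| =
    (#|isotropic_frames M k| * (c - #|F| ^ k))%N.
Proof.
move=> altM card_orth; rewrite -[k.+1]add1n.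
rewrite -[LHS]sum1_card (reindex (fun p : 'M_(k, d) * 'rV[F]_d =>
  col_mx p.2 p.1 : 'M_(1 + k, d))) /=; last first.
  exists (fun B => (dsubmx B, usubmx B)) => [[A w] | B] _ /=.
    by rewrite col_mxKu col_mxKd.
  by rewrite vsubmxK.
pose good (A : 'M_(k, d)) := [set w : 'rV[F]_d | w *m M *m A^T == 0]
                :\: [set w : 'rV_d | (w <= A)%MS].
rewrite (eq_bigl (fun p =>
  (p.1 \in isotropic_frames M k) && (p.2 \in good p.1))); last first.
  case=> A w /=; rewrite !inE /= row_free_col_mx.
  rewrite mul_col_mx tr_col_mx mul_col_row block_mx_eq0 altM eqxx.
  rewrite (alternating_mx_orthC A w altM) /=.
  case: row_free; case: submx => /=; case: (w *m M *m A^T == 0);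
    by rewrite ?andbF ?andbT.
rewrite -(pair_big_dep (fun A => A \in isotropic_frames M k)
   (fun A w => w \in good A) (fun _ _ => 1%N)) /=.
rewrite -sum_nat_const; apply: eq_bigr => A isoA.
rewrite sum1_card cardsDS ?card_orth ?card_row_space //.
  by move: isoA; rewrite inE => /andP[/eqP-> _].
apply/subsetP => w; rewrite !inE => /submxP[D ->].
move: isoA; rewrite inE -mulmxA => /andP[_ /eqP A0].
by rewrite -!mulmxA A0 mulmx0.
Qed.

Lemma card_isotropic_frames0 M : #|isotropic_frames M 0| = 1%N.
Proof.
rewrite -(cards1 (0 : 'M[F]_(0, d))); apply: eq_card => A.
by rewrite !inE [A]flatmx0 /row_free mxrank0 !mul0mx !eqxx.
Qed.

Lemma card_isotropic_frames M k : alternating_mx M -> M \in unitmx ->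
  #|isotropic_frames M k| = (\prod_(i < k) (#|F| ^ (d - i) - #|F| ^ i))%N.
Proof.
move=> altM uM; elim: k => [|k IHk].
  by rewrite big_ord0 card_isotropic_frames0.
rewrite big_ord_recr /= -IHk; apply: card_isotropic_frames_step => // A.
rewrite inE => /andP[/eqP rA _].
transitivity #|[set w : 'rV_d | (w <= kermx (M *m A^T))%MS]|.
  by apply: eq_card => w; rewrite !inE sub_kermx mulmxA.
rewrite card_row_space mxrank_ker -(mxrank_tr (M *m A^T)) trmx_mul trmxK.
by rewrite mxrankMfree ?rA // row_free_unit unitmx_tr.
Qed.

Lemma card_row_free k :
  #|[set A : 'M[F]_(k, d) | row_free A]| =
    (\prod_(i < k) (#|F| ^ d - #|F| ^ i))%N.
Proof.
(* Every frame is isotropic for the zero form, and every vector orthogonal. *)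
have -> : [set A : 'M[F]_(k, d) | row_free A] = isotropic_frames 0 k.
  by apply/setP => A; rewrite !inE mulmx0 mul0mx eqxx andbT.
elim: k => [|k IHk]; first by rewrite big_ord0 card_isotropic_frames0.
rewrite big_ord_recr /= -IHk; apply: card_isotropic_frames_step => [w | A _].
  by rewrite mulmx0 mul0mx.
rewrite -[d in RHS]mul1n -card_mx -cardsT; apply: eq_card => w.
by rewrite !inE mulmx0 mul0mx eqxx.
Qed.
End IsotropicFrames.

(** * Matrices whose rows span a given subspace *)

Section RowSpan.
Variables (F : finFieldType) (d : nat).

(** Ranks and kernels are computed on matrices, while the subspaces to be
    counted have type [{vspace _}]: [span_mx] and [basis_mx] go from one to the
    other. *)
Definition span_mx r (A : 'M[F]_(r, d)) : {vspace 'rV[F]_d} :=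
  <<[tuple row i A | i < r]>>%VS.

Lemma mem_span_mx r (A : 'M[F]_(r, d)) w : (w \in span_mx A) = (w <= A)%MS.
Proof.
apply/idP/submxP => [wA | [D ->]]; last first.
  rewrite mulmx_sum_row; apply: memv_suml => i _.
  by apply/memvZ/memv_span/tnthP; exists i; rewrite tnth_mktuple.
exists (\row_i coord [tuple row i A | i < r] i w); rewrite mulmx_sum_row.
rewrite [LHS](coord_span wA); apply: eq_bigr => i _.
by rewrite !mxE -tnth_nth tnth_mktuple.
Qed.

Lemma span_mx_eq r s (A : 'M_(r, d)) (B : 'M_(s, d)) :
  (span_mx A == span_mx B) = (A == B)%MS.
Proof.
have sub t u (C : 'M[F]_(t, d)) (D : 'M[F]_(u, d)) :
    (span_mx C <= span_mx D)%VS = (C <= D)%MS.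
  apply/subvP/row_subP => sCD => [i | w].
    by rewrite -mem_span_mx sCD // mem_span_mx row_sub.
  by rewrite !mem_span_mx => /submx_trans-> //; apply/row_subP.
by rewrite eqEsubv !sub.
Qed.

Definition basis_mx (U : {vspace 'rV[F]_d}) : 'M[F]_(\dim U, d) :=
  \matrix_i (vbasis U)`_i.

Lemma span_basis_mx U : span_mx (basis_mx U) = U.
Proof.
rewrite -[RHS](span_basis (vbasisP U)) /span_mx; congr (<<_>>%VS).
congr val; apply: eq_from_tnth => i.
by rewrite tnth_mktuple rowK (tnth_nth 0).
Qed.

Lemma basis_mx_free U : row_free (basis_mx U).
Proof.
apply: inj_row_free => v; rewrite mulmx_sum_row => v0; apply/rowP => i.
have /freeP free_b := basis_free (vbasisP U).
rewrite mxE; apply: free_b i; rewrite -[RHS]v0.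
by apply: eq_bigr => j _; rewrite rowK.
Qed.

Lemma dim_span_mx r (A : 'M[F]_(r, d)) : \dim (span_mx A) = \rank A.
Proof.
have /eqP := span_basis_mx (span_mx A); rewrite span_mx_eq => /eqmx_rank <-.
by rewrite (eqP (basis_mx_free _)).
Qed.

(** Writing the rows in a basis of [U] identifies the spanning tuples of [U]
    with the matrices of full column rank, that is, with the transposes of the
    [\dim U]-by-[r] matrices whose rows are free. *)
Lemma card_spanning_matrices r (U : {vspace 'rV[F]_d}) :
  #|[set A : 'M[F]_(r, d) | span_mx A == U]| =
    (\prod_(i < \dim U) (#|F| ^ r - #|F| ^ i))%N.
Proof.
rewrite -(card_row_free F r (\dim U)).
have inj : injective (fun C : 'M[F]_(\dim U, r) => C^T *m basis_mx U).
  by move=> C D /(row_free_inj (basis_mx_free U))/trmx_inj.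
rewrite -(card_imset _ inj); apply: eq_card => A.
rewrite inE -[X in _ == X](span_basis_mx U) span_mx_eq.
apply/idP/imsetP => [/andP[/submxP[D defA] sBA] | [C]].
  exists (D^T); last by rewrite trmxK.
  rewrite inE /row_free mxrank_tr.
  move: sBA; rewrite defA => /mxrankS; rewrite (eqP (basis_mx_free U)) => le.
  by rewrite eqn_leq rank_leq_col (leq_trans le) // mxrankM_maxl.
rewrite inE => /eqP rC ->; rewrite submxMl /=.
by rewrite eqmxMfull ?submx_refl // /row_full mxrank_tr rC.
Qed.

End RowSpan.

(** * Isotropic tuples and isotropic subspaces of an alternating form *)

Section BilinearForms.
Variables (F : finFieldType) (d : nat) (B : {biscalar 'rV[F]_d}).
Let M := matrix_of_form B.

Lemma biscalar_mxE u v : B u v = (u *m M *m v^T) 0 0.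
Proof.
rewrite [u in LHS]row_sum_delta [v in LHS]row_sum_delta linear_sum /= !mxE.
apply: eq_bigr => j _; rewrite linear_sumlz !mxE big_distrl /=.
by apply: eq_bigr => i _; rewrite linearZlr /= !mxE; ring.
Qed.

Lemma biscalar_mx11 u v : u *m M *m v^T = (B u v)%:M.
Proof. by rewrite [LHS]mx11_scalar biscalar_mxE. Qed.

Lemma alternating_mx_of_form : alternating_form B -> alternating_mx M.
Proof. by move=> altB w; rewrite biscalar_mx11 altB raddf0. Qed.

Lemma nondegenerate_unitmx : nondegenerate_form B -> M \in unitmx.
Proof.
move=> ndB; rewrite -row_free_unit; apply: inj_row_free => u uM0.
by apply: ndB => v; rewrite biscalar_mxE uM0 mul0mx mxE.
Qed.

Lemma gram_mx_eq0 r (A : 'M_(r, d)) :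
  (A *m M *m A^T == 0) = [forall i, forall j, B (row i A) (row j A) == 0].
Proof.
have E i j : (A *m M *m A^T) i j = B (row i A) (row j A).
  rewrite biscalar_mxE -!row_mul !mxE.
  by apply: eq_bigr => k _; rewrite !mxE.
apply/eqP/forallP => [A0 i | A0].
  by apply/forallP => j; rewrite -E A0 mxE.
apply/matrixP=> i j; rewrite E mxE; apply/eqP.
by have /forallP := A0 i.
Qed.

Lemma totally_isotropic_span_mx r (A : 'M_(r, d)) :
  totally_isotropic B (span_mx A) = (A *m M *m A^T == 0).
Proof.
apply/forall_inP/eqP => [isoA | A0 u].
  apply/eqP; rewrite gram_mx_eq0; apply/forallP => i; apply/forallP => j.
  have rowA k : row k A \in span_mx A by rewrite mem_span_mx row_sub.
  exact: (forall_inP (isoA _ (rowA i)) _ (rowA j)).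
rewrite mem_span_mx => /submxP[D ->]; apply/forall_inP => v.
rewrite mem_span_mx => /submxP[E ->]; rewrite biscalar_mxE trmx_mul.
have -> : D *m A *m M *m (A^T *m E^T) = D *m (A *m M *m A^T) *m E^T.
  by rewrite !mulmxA.
by rewrite A0 mulmx0 mul0mx mxE.
Qed.

Lemma card_isotropic_tuples_mx r : alternating_form B ->
  #|isotropic_tuples B r| = #|[set A : 'M[F]_(r, d) | A *m M *m A^T == 0]|.
Proof.
move=> altB; pose f (v : {ffun 'I_r -> 'rV[F]_d}) := \matrix_i v i.
have inj : injective f.
  move=> v w /matrixP vw; apply/ffunP => i; apply/rowP => j.
  by have := vw i j; rewrite !mxE.
have anti u v : B u v = - B v u.
  have := altB (u + v); rewrite linearDl !linearDr /= !altB add0r addr0.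
  by move/eqP; rewrite addr_eq0 => /eqP.
rewrite -(card_imset _ inj); apply: eq_card => A; rewrite inE gram_mx_eq0.
apply/imsetP/forallP => [[v] | A0].
  rewrite inE => /forallP v0 -> i; apply/forallP => j; rewrite !rowK.
  have [ij | ji | /val_inj <-] := ltngtP i j.
  - by have /forallP/(_ j)/implyP := v0 i; apply.
  - by rewrite anti oppr_eq0; have /forallP/(_ i)/implyP := v0 j; apply.
  - by rewrite altB.
exists [ffun i => row i A]; last by apply/row_matrixP => i; rewrite rowK ffunE.
rewrite inE; apply/forallP => i; apply/forallP => j; apply/implyP => _.
by rewrite !ffunE; have /forallP := A0 i.
Qed.

(** The matrices are sorted by the span of their rows. *)
Lemma card_isotropic_of_rank r k :
  #|[set A : 'M[F]_(r, d) | (A *m M *m A^T == 0) && (\rank A == k)]| =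
  (#|isotropic_subspaces B k| * \prod_(i < k) (#|F| ^ r - #|F| ^ i))%N.
Proof.
rewrite -sum1_card (partition_big (fun A => span_mx A)
   (fun U => U \in isotropic_subspaces B k)) /=; last first.
  by move=> A; rewrite !inE totally_isotropic_span_mx dim_span_mx andbC.
rewrite -sum_nat_const; apply: eq_bigr => U.
rewrite inE => /andP[/eqP dimU isoU].
rewrite -[in RHS]dimU -card_spanning_matrices.
rewrite sum1_card; apply: eq_card => A; rewrite !inE.
rewrite unfold_in /= inE -totally_isotropic_span_mx -dim_span_mx.
by have [-> | _] := eqVneq (span_mx A) U; rewrite ?isoU ?dimU ?eqxx ?andbF.
Qed.

Lemma card_isotropic_tuples r : alternating_form B ->
  #|isotropic_tuples B r| =
  (\sum_(k < r.+1)
    #|isotropic_subspaces B k| * \prod_(i < k) (#|F| ^ r - #|F| ^ i))%N.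
Proof.
move=> altB; rewrite card_isotropic_tuples_mx // -sum1_card.
rewrite (partition_big (fun A : 'M_(r, d) => inord (\rank A) : 'I_r.+1)
  xpredT) //=.
apply: eq_bigr => k _; rewrite -card_isotropic_of_rank sum1_card.
apply: eq_card => A; rewrite unfold_in /= !inE; congr (_ && _).
by rewrite -(inj_eq val_inj) /= inordK // ltnS rank_leq_row.
Qed.

(** Both sides count the bases of the [k]-dimensional isotropic subspaces: on
    the left subspace by subspace, on the right vector by vector. *)
Lemma card_isotropic_subspaces k : alternating_form B -> nondegenerate_form B ->
  (#|isotropic_subspaces B k| * \prod_(i < k) (#|F| ^ k - #|F| ^ i) =
   \prod_(i < k) (#|F| ^ (d - i) - #|F| ^ i))%N.
Proof.
move=> altB ndB.
rewrite -card_isotropic_of_rank -(@card_isotropic_frames _ _ M).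
- by apply: eq_card => A; rewrite !inE andbC.
- exact: alternating_mx_of_form.
- exact: nondegenerate_unitmx.
Qed.

End BilinearForms.

(** * Commuting tuples of a group of Heisenberg type *)

Section HeisenbergCounting.
Variables (F : finFieldType) (n : nat) (gT : finGroupType) (G : {group gT}).
Variable S : heisenberg_structure F n G.
Let B := hs_form S.

Local Notation cls := (fun g : gT => hs_coord S (coset 'Z(G) g)).

Lemma hs_comm1 : hs_comm S 1%g = 0.
Proof.
apply: (@addIr _ (hs_comm S 1%g)); rewrite add0r -hs_commM ?group1 //.
by rewrite mulg1.
Qed.

Lemma hs_form_comm_eq0 g h : g \in G -> h \in G ->
  (B (cls g) (cls h) == 0) = (g * h == h * g)%g.
Proof.
move=> Gg Gh; rewrite /B hs_formE ?mem_quotient // comm_mapE //.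
have ghG' : [~ g, h]%g \in (G^`(1))%g by apply: mem_commg.
rewrite -hs_comm1 (inj_in_eq (@hs_comm_inj _ _ _ _ S)) ?group1 //.
exact/commgP/eqP.
Qed.

Lemma card_cls_fiber v : #|[set g in G | cls g == v]| = #|'Z(G)%g|.
Proof.
have : v \in hs_coord S @: (G / 'Z(G))%g by rewrite hs_coord_surj inE.
case/imsetP => a /morphimP[g0 N0 G0 ->] ->.
rewrite -(card_rcoset 'Z(G)%g g0); apply: eq_card => g; rewrite inE.
have nZ : G \subset 'N('Z(G))%g by apply: normal_norm; apply: center_normal.
have sZ : 'Z(G)%g \subset G by apply: center_sub.
apply/andP/idP => [[Gg] | gZ].
  rewrite (inj_in_eq (@hs_coord_inj _ _ _ _ S)) ?mem_quotient // => /eqP.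
  by move/rcoset_kercosetP; apply; apply: (subsetP nZ).
have Gg : g \in G.
  by case/rcosetP: gZ => z /(subsetP sZ) Gz ->; rewrite groupM.
by split=> //; apply/eqP; congr hs_coord; apply/rcoset_kercosetP => //;
  apply: (subsetP nZ).
Qed.

Lemma card_heisenberg_quotient : #|(G / 'Z(G))%g| = (#|F| ^ (2 * n))%N.
Proof.
rewrite -(card_in_imset (@hs_coord_inj _ _ _ _ S)).
by rewrite hs_coord_surj cardsT card_mx mul1n.
Qed.

Lemma card_heisenberg_derived : #|(G^`(1))%g| = #|F|.
Proof.
by rewrite -(card_in_imset (@hs_comm_inj _ _ _ _ S)) hs_comm_surj cardsT.
Qed.

Lemma card_heisenberg_center : #|G| = (#|'Z(G)%g| * #|F| ^ (2 * n))%N.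
Proof.
rewrite -(Lagrange (center_sub G)) -card_quotient; last first.
  by apply: normal_norm; apply: center_normal.
by rewrite card_heisenberg_quotient.
Qed.

(** Commuting of [x_i] and [x_j] depends only on their classes modulo the
    center, and each class has [#|'Z(G)|] representatives. *)
Lemma card_comm_tuples r :
  #|comm_tuples G r| = (#|'Z(G)%g| ^ r * #|isotropic_tuples B r|)%N.
Proof.
pose f (x : {ffun 'I_r -> gT}) := [ffun i => cls (x i)].
have comP x : (x \in comm_tuples G r) =
    [forall i, x i \in G] && (f x \in isotropic_tuples B r).
  rewrite !inE; apply: andb_id2l => /forallP Gx.
  apply/forallP/forallP => xC i; apply/forallP => j.
    apply/implyP => _; rewrite !ffunE hs_form_comm_eq0 //.
    by have /forallP := xC i.
  have [ij | ji | /val_inj <-] := ltngtP i j; last by [].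
    have /forallP/(_ j)/implyP/(_ ij) := xC i.
    by rewrite !ffunE hs_form_comm_eq0.
  have /forallP/(_ i)/implyP/(_ ji) := xC j.
  by rewrite !ffunE hs_form_comm_eq0 // eq_sym.
rewrite -sum1_card (partition_big f (fun v => v \in isotropic_tuples B r)) /=;
  last by move=> x; rewrite comP => /andP[].
rewrite [RHS]mulnC -sum_nat_const; apply: eq_bigr => v isoV.
rewrite sum1_card.
transitivity #|family (fun i => [set g in G | cls g == v i])|.
  apply: eq_card => x; rewrite unfold_in /= comP.
  apply/andP/familyP => [[/andP[/forallP Gx _] /eqP <- i] | Hx].
    by rewrite !inE Gx ffunE eqxx.
  have fx : f x = v.
    by apply/ffunP => i; have := Hx i; rewrite inE ffunE => /andP[_ /eqP].
  rewrite fx isoV eqxx andbT; split=> //; apply/forallP => i.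
  by have := Hx i; rewrite inE => /andP[].
rewrite card_family foldrE big_map big_enum /=.
under eq_bigr do rewrite card_cls_fiber.
by rewrite prod_nat_const card_ord.
Qed.

End HeisenbergCounting.

Definition isotropic_subspace_count (q n k : nat) : rat :=
  \prod_(i < k) ((q%:R ^+ (2 * n - 2 * i) - 1) / (q%:R ^+ (k - i) - 1)).

Definition isotropic_count (q n r : nat) : rat :=
  \sum_(k < (minn n r).+1)
    isotropic_subspace_count q n k * \prod_(i < k) (q%:R ^+ r - q%:R ^+ i).

Lemma natr_falling_powers (q r k : nat) : (0 < q)%N ->
  (\prod_(i < k) (q ^ r - q ^ i))%N%:R =
    \prod_(i < k) (q%:R ^+ r - q%:R ^+ i) :> rat.
Proof.
move=> q0; have [kr | rk] := leqP k r.
  rewrite natr_prod; apply: eq_bigr => i _.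
  by rewrite natrB ?natrX // leq_pexp2l // (leq_trans _ kr) // ltnW.
rewrite (bigD1 (Ordinal rk)) //= [RHS](bigD1 (Ordinal rk)) //=.
by rewrite subnn subrr !mul0r.
Qed.

Lemma isotropic_subspace_count_gt n k q : (n < k)%N ->
  isotropic_subspace_count q n k = 0.
Proof.
move=> nk; rewrite /isotropic_subspace_count (bigD1 (Ordinal nk)) //=.
by rewrite subnn expr0 subrr !mul0r.
Qed.

Lemma expr_sub1_neq0 q m : (1 < q)%N -> (0 < m)%N ->
  q%:R ^+ m - 1 != 0 :> rat.
Proof.
move=> q1 m0; rewrite subr_eq0 -natrX -[1]/(1%:R) eqr_nat.
by rewrite -(expn0 q) eqn_exp2l // -lt0n.
Qed.

(** Beyond [minn n r] one of the two products has a zero factor: the one of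
    index [n] in the first product, or the one of index [r] in the second. *)
Lemma isotropic_count_widen q n r N : (minn n r <= N)%N ->
  isotropic_count q n r = \sum_(k < N.+1)
    isotropic_subspace_count q n k * \prod_(i < k) (q%:R ^+ r - q%:R ^+ i).
Proof.
move=> minN; rewrite /isotropic_count (big_ord_widen N.+1
  (fun k => isotropic_subspace_count q n k *
     \prod_(i < k) (q%:R ^+ r - q%:R ^+ i))) //.
rewrite big_mkcond /=; apply: eq_bigr => k _.
case: ifP => // /negbT; rewrite ltnS leq_min negb_and -!ltnNge => /orP[nk | rk].
  by rewrite isotropic_subspace_count_gt ?mul0r.
by rewrite (bigD1 (Ordinal rk)) //= subrr mul0r mulr0.
Qed.

Section SymplecticCounts.
Variables (F : finFieldType) (n : nat) (B : {biscalar 'rV[F]_(2 * n)}).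
Hypotheses (altB : alternating_form B) (ndB : nondegenerate_form B).

Lemma card_isotropic_subspacesE k :
  #|isotropic_subspaces B k|%:R = isotropic_subspace_count #|F| n k.
Proof.
set q := #|F|; have q1 : (1 < q)%N := finNzRing_gt1 F.
have q0 : (0 < q)%N := ltnW q1.
have pq m i : (i <= m)%N ->
    (q ^ m - q ^ i)%N%:R = q%:R ^+ i * (q%:R ^+ (m - i) - 1) :> rat.
  by move=> im; rewrite natrB ?leq_pexp2l // !natrX mulrBr mulr1 -exprD subnKC.
have qz : q%:R != 0 :> rat by rewrite pnatr_eq0 -lt0n.
have := card_isotropic_subspaces k altB ndB; rewrite -/q.
have [kn | nk] := leqP k n => /(congr1 (fun m => m%:R : rat)).
  rewrite natrM !natr_prod => /(canRL (mulfK _)) ->; last first.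
    apply/prodf_neq0 => i _; rewrite pq 1?ltnW // mulf_neq0 ?expf_neq0 //.
    by rewrite expr_sub1_neq0 // subn_gt0.
  rewrite /isotropic_subspace_count -prodf_div; apply: eq_bigr => i _.
  have ik := ltn_ord i; rewrite !pq; [|lia|lia].
  rewrite -mulf_div divff ?mul1r ?expf_neq0 //; congr ((_ ^+ _ - 1) / _); lia.
(* The factor of index [n] is [q ^ n - q ^ n]: there is no isotropic frame. *)
have -> : (\prod_(i < k) (q ^ (2 * n - i) - q ^ i) = 0)%N.
  by rewrite (bigD1 (Ordinal nk)) //= mul2n -addnn addnK subnn mul0n.
move/eqP; rewrite isotropic_subspace_count_gt // pnatr_eq0 muln_eq0.
case/orP=> [/eqP-> // |].
rewrite eqn0Ngt prodn_gt0 // => i.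
by rewrite subn_gt0 ltn_exp2l.
Qed.

Lemma card_isotropic_tuplesE r :
  #|isotropic_tuples B r|%:R = isotropic_count #|F| n r.
Proof.
rewrite card_isotropic_tuples // natr_sum.
rewrite (isotropic_count_widen _ (geq_minr n r)).
apply: eq_bigr => k _; rewrite natrM card_isotropic_subspacesE.
by rewrite natr_falling_powers // ltnW // finNzRing_gt1.
Qed.
End SymplecticCounts.

Definition heisenberg_prob (q n r : nat) : rat :=
  q%:R ^- (2 * n * r) * isotropic_count q n r.

Section HeisenbergProb.
Variables (F : finFieldType) (n : nat) (gT : finGroupType) (G : {group gT}).
Variable S : heisenberg_structure F n G.

Lemma card_comm_tuplesE r :
  #|comm_tuples G r|%:R = #|'Z(G)%g|%:R ^+ r * isotropic_count #|F| n r.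
Proof.
rewrite (card_comm_tuples S) natrM natrX card_isotropic_tuplesE //.
  exact: hs_alternating.
exact: hs_nondegenerate.
Qed.

Lemma comm_probE r : comm_prob G r = heisenberg_prob #|F| n r.
Proof.
rewrite /comm_prob card_comm_tuplesE (card_heisenberg_center S) natrM natrX.
rewrite exprMn -exprM invfM mulrACA divff ?mul1r 1?mulrC //.
by rewrite expf_neq0 // pnatr_eq0 -lt0n cardG_gt0.
Qed.

End HeisenbergProb.

(** * Two probabilities determine the parameters *)

Section ClosedForms.
Variables (q n : nat).
Hypotheses (q1 : (1 < q)%N) (n0 : (0 < n)%N).
Let Q : rat := q%:R.
Let t : rat := Q ^- (2 * n).

Let Q0 : Q != 0. Proof. by rewrite pnatr_eq0 -lt0n ltnW. Qed.

Let expQ_neq1 m : (0 < m)%N -> Q ^+ m - 1 != 0.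
Proof. exact: expr_sub1_neq0. Qed.

Lemma heisenberg_prob2 : heisenberg_prob q n 2 = (1 + (Q - 1) * t) / Q.
Proof.
rewrite /heisenberg_prob (isotropic_count_widen _ (geq_minr n 2)).
rewrite !big_ord_recl big_ord0 /isotropic_subspace_count /=.
rewrite !big_ord_recl !big_ord0.
rewrite -/Q /t /bump /= !subn0 ?muln0 ?subn0 ?addn0 !expr0 ?muln1.
case: n n0 => // k _; set u := (2 * k)%N.
have -> : (2 * k.+1 * 2 = u * 2 + 4)%N by lia.
have -> : (2 * k.+1 - 2 = u)%N by lia.
have -> : (2 * k.+1 = u + 2)%N by lia.
rewrite (exprD Q (u * 2)) (exprD Q u) exprM; set X := Q ^+ u.
have X0 : X != 0 by rewrite expf_neq0.
have := expQ_neq1 (ltn0Sn 0); have := expQ_neq1 (ltn0Sn 1) => /= nz2 nz1.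
by field; rewrite X0 Q0 nz1 nz2.
Qed.

Lemma heisenberg_prob3 : heisenberg_prob q n 3 =
  heisenberg_prob q n 2 + (heisenberg_prob q n 2 - 1) * (Q + 1) / Q ^+ 2.
Proof.
rewrite heisenberg_prob2 /heisenberg_prob.
rewrite (isotropic_count_widen _ (geq_minr n 3)).
rewrite !big_ord_recl big_ord0 /isotropic_subspace_count /=.
rewrite !big_ord_recl !big_ord0.
rewrite -/Q /t /bump /=.
rewrite !subn0 ?muln0 ?subn0 ?addn0 !expr0 ?muln1.
have := expQ_neq1 (ltn0Sn 0); have := expQ_neq1 (ltn0Sn 1).
have := expQ_neq1 (ltn0Sn 2) => /= nz3 nz2 nz1.
(* In the number of 3-dimensional subspaces, the exponent [2n - 4] of the third
   factor is exact only for [n >= 2]; for [n = 1] the second factor, whose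
   exponent is [2n - 2], already vanishes. *)
case: n n0 => // -[_ | k _].
  rewrite muln1 subnn expr0 subrr !mul0r ?mulr0 !mul0r.
  by field; rewrite Q0 nz1.
set u := (2 * k)%N; have -> : (2 * k.+2 * 3 = u * 3 + 12)%N by lia.
have -> : (2 * k.+2 - 2 = u + 2)%N by lia.
have -> : (2 * k.+2 - 2 * 2 = u)%N by lia.
have -> : (2 * k.+2 = u + 4)%N by lia.
rewrite (exprD Q (u * 3)) !(exprD Q u) exprM; set X := Q ^+ u.
have X0 : X != 0 by rewrite expf_neq0.
by field; rewrite X0 Q0 nz1 nz2 nz3.
Qed.

Lemma heisenberg_prob2_lt1 : heisenberg_prob q n 2 < 1.
Proof.
have Q1 : 1 < Q by rewrite /Q ltr1n.
have t1 : t < 1.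
  have X1 : 1 < Q ^+ (2 * n) by rewrite exprn_egt1 // muln_eq0 -lt0n.
  by rewrite /t invf_lt1 // (lt_trans ltr01).
rewrite heisenberg_prob2 ltr_pdivrMr ?mul1r ?(lt_trans ltr01) //.
by nra.
Qed.

(** By [heisenberg_prob3] the polynomial is
    [(1 - P_2) / q^2 * (X - q) * ((q + 1) * X + q)], whose second root is
    negative. *)
Lemma heisenberg_quadratic (R : realFieldType) (x : R) : 0 < x ->
  (ratr (heisenberg_prob q n 2 - heisenberg_prob q n 3) * x ^+ 2
    + ratr (heisenberg_prob q n 2 - 1) * x
    + ratr (heisenberg_prob q n 2 - 1) = 0
   <-> x = q%:R).
Proof.
move=> x0; rewrite heisenberg_prob3; set P := heisenberg_prob q n 2.
have P1 : P - 1 != 0 by rewrite subr_eq0 lt_eqF // heisenberg_prob2_lt1.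
have q0 : 0 < q%:R :> R by rewrite ltr0n ltnW.
rewrite opprD addrA subrr add0r rmorphN rmorphM fmorphV rmorphM rmorphXn /=.
rewrite [ratr (Q + 1)]rmorphD rmorph1 /= !ratr_nat; set c := ratr (P - 1).
have c0 : c != 0 by rewrite fmorph_eq0.
have -> : - (c * (q%:R + 1) / q%:R ^+ 2) * x ^+ 2 + c * x + c =
    - c / q%:R ^+ 2 * (x - q%:R) * ((q%:R + 1) * x + q%:R).
  by field; rewrite gt_eqF.
split=> [/eqP | ->]; last by rewrite subrr mulr0 mul0r.
rewrite !mulf_eq0 invr_eq0 oppr_eq0 (negPf c0) expf_eq0 /= (gt_eqF q0) /=.
case/orP=> [|/eqP]; first by rewrite subr_eq0 => /eqP.
by move=> E; exfalso; nra.
Qed.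

Lemma heisenberg_rank : t = (Q * heisenberg_prob q n 2 - 1) / (Q - 1).
Proof.
by rewrite heisenberg_prob2; field; rewrite Q0 (expQ_neq1 (ltn0Sn 0)).
Qed.
End ClosedForms.

Lemma heisenberg_prob_inj q n q' n' :
  (1 < q)%N -> (0 < n)%N -> (1 < q')%N -> (0 < n')%N ->
  heisenberg_prob q n 2 = heisenberg_prob q' n' 2 ->
  heisenberg_prob q n 3 = heisenberg_prob q' n' 3 -> (q, n) = (q', n').
Proof.
move=> q1 n0 q1' n0' e2 e3.
have q0 : 0 < q%:R :> rat by rewrite ltr0n ltnW.
have /eqP : q%:R = q'%:R :> rat.
  apply/(heisenberg_quadratic q1' n0' q0); rewrite -e2 -e3.
  exact/(heisenberg_quadratic q1 n0 q0).
rewrite eqr_nat => /eqP qq; rewrite -qq in q1' e2 *.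
have /eqP := heisenberg_rank q1 n0; rewrite e2 -(heisenberg_rank q1 n0').
rewrite (inj_eq invr_inj) -!natrX eqr_nat eqn_exp2l // eqn_pmul2l //.
by move/eqP->.
Qed.

(** * Poles of a combination of geometric series *)

(** Both products are [D * D'] times the series. The coefficient of degree [K]
    involves only the polynomial [A] of the terms of degree at most [K] of the
    series. *)
Lemma series_eq_frac_cross (a : nat -> rat) (N D N' D' : {poly rat}) :
  series_eq_frac a N D -> series_eq_frac a N' D' -> N * D' = N' * D.
Proof.
move=> [_ aND] [_ aND']; apply/polyP => K.
pose A := \poly_(i < K.+1) a i.
have trunc (N1 D1 : {poly rat}) :
    (forall m : nat, \sum_(i < m.+1) D1`_i * a (m - i)%N = N1`_m) ->
    forall m, (m <= K)%N -> (D1 * A)`_m = N1`_m.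
  move=> E m mK; rewrite coefM -E; apply: eq_bigr => i _.
  by rewrite coef_poly ltnS (leq_trans (leq_subr _ _) mK).
transitivity (D * A * D')`_K.
  rewrite !coefM; apply: eq_bigr => i _.
  by rewrite (trunc N D) // -ltnS.
rewrite [D * A * D'](_ : _ = D' * A * D); last by ring.
rewrite !coefM; apply: eq_bigr => i _.
by rewrite (trunc N' D') // -ltnS.
Qed.

(** The generating series of [c^-s] is [- c / (X - c)]. *)
Lemma geometric_series_frac (c : rat) (E : {poly rat}) k : c != 0 ->
  \sum_(i < k.+1) (('X - c%:P) * E)`_i * c^-1 ^+ (k - i) = - c * E`_k.
Proof.
move=> c0; have coefE i : (('X - c%:P) * E)`_i.+1 = E`_i - c * E`_i.+1.
  by rewrite mulrBl coefB coefXM coefCM.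
elim: k => [|k IHk].
  rewrite big_ord_recl big_ord0 addr0 mulr1 mulrBl coefB coefXM coefCM.
  by rewrite sub0r mulNr.
rewrite big_ord_recr /= subnn mulr1 coefE.
under eq_bigr => i _ do rewrite subSn -1?ltnS // exprS mulrCA.
by rewrite -mulr_sumr IHk; field.
Qed.

Section ExponentialSeries.
Variables (I : finType) (b mu : I -> rat).
Hypotheses (mu_inj : injective mu) (mu_neq0 : forall j, mu j != 0).

Let a s := \sum_j b j * (mu j)^-1 ^+ s.
(* Leaving out the [j] with [b j = 0] puts [N / D] in lowest terms. *)
Let D := \prod_(j | b j != 0) ('X - (mu j)%:P).
Let D_ j := \prod_(i | (b i != 0) && (i != j)) ('X - (mu i)%:P).
Let N := \sum_(j | b j != 0) (- (b j * mu j)) *: D_ j.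

Let DE j : b j != 0 -> D = ('X - (mu j)%:P) * D_ j.
Proof. by move=> bj; rewrite /D (bigD1 j). Qed.

Lemma exp_series_eq_frac : series_eq_frac a N D.
Proof.
split; first by apply/prodf_neq0 => j _; rewrite polyXsubC_eq0.
move=> k; rewrite /a; under eq_bigr => i _ do rewrite mulr_sumr.
rewrite exchange_big /= /N coef_sum [RHS]big_mkcond /=; apply: eq_bigr => j _.
have [bj | bj] := ifPn; last first.
  by rewrite big1 // => i _; rewrite (eqP (negPn bj)) mul0r mulr0.
rewrite coefZ (DE bj).
under eq_bigr => i _ do rewrite mulrCA.
by rewrite -mulr_sumr geometric_series_frac // mulrA mulrN.
Qed.

(** At [mu j] all the terms of [N] vanish, except the [j]-th one. *)
Lemma exp_series_coprime : coprimep N D.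
Proof.
apply: (big_ind (fun p => coprimep N p)); first exact: coprimep1.
  by move=> p r; rewrite coprimepMr => -> ->.
move=> j bj; rewrite coprimep_XsubC rootE /N horner_sum (bigD1 j) //=.
rewrite big1 => [|i /andP[_ ij]].
  rewrite addr0 hornerZ mulf_neq0 ?oppr_eq0 ?mulf_neq0 // horner_prod.
  apply/prodf_neq0 => i /andP[_ ij].
  by rewrite hornerXsubC subr_eq0 (inj_eq mu_inj) eq_sym.
rewrite hornerZ /D_ (bigD1 j) /=; last by rewrite bj eq_sym.
by rewrite hornerM hornerXsubC subrr mul0r mulr0.
Qed.

(** If [N1 / D1] is another reduced fraction of the series, then [D1] divides
    [N1 * D = N * D1] and is prime to [N1], hence divides [D]. *)
Lemma exp_series_poleP (C : numClosedFieldType) (z : C) :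
  series_pole a z <-> exists2 j, b j != 0 & z = ratr (mu j).
Proof.
have rootD : root (map_poly ratr D) z <-> exists2 j, b j != 0 & z = ratr (mu j).
  rewrite /D rmorph_prod /= rootE horner_prod; split.
    rewrite prodf_seq_eq0 => /hasP[j _ /andP[bj]].
    by rewrite map_polyXsubC hornerXsubC subr_eq0 => /eqP; exists j.
  move=> [j bj ->]; apply/eqP; rewrite (bigD1 j) //=.
  by rewrite map_polyXsubC hornerXsubC subrr mul0r.
split=> [[N1 [D1 [aND1 cop root1]]] | /rootD rD]; last first.
  exists N, D; split=> //; first exact: exp_series_eq_frac.
  exact: exp_series_coprime.
apply/rootD; have dvd : D1 %| D.
  have := series_eq_frac_cross aND1 exp_series_eq_frac => E.
  by rewrite coprimep_sym in cop; rewrite -(Gauss_dvdpr D cop) E dvdp_mull.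
by have /dvdpP[E ->] := dvd; rewrite rmorphM /= rootM root1 orbT.
Qed.
End ExponentialSeries.

(** The value [I_r(n)] as a polynomial in [q^r]: its coefficients are those of
    [P_r] as a combination of the geometric sequences of ratios [q^(j - 2n)]. *)
Definition isotropic_count_poly (q n : nat) : {poly rat} :=
  \sum_(k < n.+1)
    isotropic_subspace_count q n k *: \prod_(i < k) ('X - (q%:R ^+ i)%:P).

Lemma size_prod_XsubC_ord (c : nat -> rat) k :
  size (\prod_(i < k) ('X - (c i)%:P)) = k.+1.
Proof.
rewrite -(big_mkord xpredT (fun i => 'X - (c i)%:P)) size_prod_XsubC.
by rewrite size_iota subn0.
Qed.

Lemma isotropic_count_polyE q n r :
  isotropic_count q n r = (isotropic_count_poly q n).[q%:R ^+ r].
Proof.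
rewrite (isotropic_count_widen _ (geq_minl n r)) horner_sum.
apply: eq_bigr => k _; rewrite hornerZ horner_prod; congr (_ * _).
by apply: eq_bigr => i _; rewrite hornerXsubC.
Qed.

Lemma size_isotropic_count_poly q n :
  (size (isotropic_count_poly q n) <= n.+1)%N.
Proof.
apply: (leq_trans (size_sum _ _ _)); apply/bigmax_leqP => k _.
apply: (leq_trans (size_scale_leq _ _)).
by rewrite (size_prod_XsubC_ord (fun i => q%:R ^+ i)).
Qed.

Lemma lead_isotropic_count_poly q n :
  (isotropic_count_poly q n)`_n = isotropic_subspace_count q n n.
Proof.
rewrite coef_sum big_ord_recr /= big1 => [|k _].
  rewrite add0r coefZ; set p := \prod_(i < n) _.
  have /monicP : p \is monic by apply: monic_prod_XsubC.
  rewrite lead_coefE (size_prod_XsubC_ord (fun i => q%:R ^+ i)) => ->.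
  by rewrite mulr1.
rewrite coefZ nth_default ?mulr0 //.
by rewrite (size_prod_XsubC_ord (fun i => q%:R ^+ i)).
Qed.

Lemma isotropic_subspace_count_neq0 q n k : (1 < q)%N -> (k <= n)%N ->
  isotropic_subspace_count q n k != 0.
Proof.
move=> q1 kn; apply/prodf_neq0 => i _; have ik := ltn_ord i.
by rewrite mulf_neq0 ?invr_eq0 ?expr_sub1_neq0 //; lia.
Qed.

Section HeisenbergSeries.
Variables (q n : nat).
Hypothesis q1 : (1 < q)%N.
Let mu (j : 'I_n.+1) : rat := q%:R ^+ (2 * n - j).
Let b (j : 'I_n.+1) : rat := (isotropic_count_poly q n)`_j * (mu j)^-1 ^+ 2.

Let mu_neq0 j : mu j != 0.
Proof. by rewrite expf_neq0 // pnatr_eq0 -lt0n ltnW. Qed.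

Let mu_inj : injective mu.
Proof.
move=> i j /eqP; rewrite /mu -!natrX eqr_nat eqn_exp2l // => /eqP ij.
by apply: val_inj => /=; have := ltn_ord i; have := ltn_ord j; lia.
Qed.

Lemma heisenberg_prob_exp s :
  heisenberg_prob q n s.+2 = \sum_j b j * (mu j)^-1 ^+ s.
Proof.
rewrite /heisenberg_prob isotropic_count_polyE.
rewrite (horner_coef_wide _ (size_isotropic_count_poly q n)) mulr_sumr.
pose Q : rat := q%:R; have qz : Q != 0 by rewrite pnatr_eq0 -lt0n ltnW.
apply: eq_bigr => j _; rewrite /b -mulrA -exprD add2n mulrCA; congr (_ * _).
rewrite -exprM exprVn -exprM -/Q.
have -> : (2 * n * s.+2 = (2 * n - j) * s.+2 + s.+2 * j)%N.
  by have := ltn_ord j; nia.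
by rewrite exprD invfM -mulrA mulVf ?mulr1 // expf_neq0.
Qed.

Let heisenberg_series_poleP (C : numClosedFieldType) (z : C) :
  series_pole (fun s => heisenberg_prob q n s.+2) z <->
  exists2 j, b j != 0 & z = ratr (mu j).
Proof.
rewrite -(exp_series_poleP b mu_inj mu_neq0); split=> -[N [D [[D0 E] cop rt]]];
  exists N, D; split=> //; split=> // m; rewrite -E; apply: eq_bigr => i _.
  by rewrite heisenberg_prob_exp.
by rewrite heisenberg_prob_exp.
Qed.

Lemma heisenberg_series_rational :
  rational_series (fun s => heisenberg_prob q n s.+2).
Proof.
have [D0 E] := exp_series_eq_frac b mu_neq0.
eexists; eexists; split; first exact: D0.
move=> m; apply: etrans (E m); apply: eq_bigr => i _.
by rewrite heisenberg_prob_exp.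
Qed.

Lemma heisenberg_series_pole (C : numClosedFieldType) (z : C) :
  series_pole (fun s => heisenberg_prob q n s.+2) z ->
  exists2 j : nat, (n <= j <= 2 * n)%N & z = q%:R ^+ j.
Proof.
case/heisenberg_series_poleP => j _ ->; exists (2 * n - j)%N.
  by have := ltn_ord j; lia.
by rewrite rmorphXn /= ratr_nat.
Qed.

Lemma heisenberg_series_pole_rank (C : numClosedFieldType) :
  series_pole (fun s => heisenberg_prob q n s.+2) (q%:R ^+ n : C).
Proof.
apply/heisenberg_series_poleP; exists ord_max.
  rewrite /b /= lead_isotropic_count_poly.
  by rewrite mulf_neq0 ?isotropic_subspace_count_neq0 ?expf_neq0 ?invr_eq0.
by rewrite /mu rmorphXn /= ratr_nat mul2n -addnn addnK.
Qed.

End HeisenbergSeries.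

(** * Finite fields of the same order *)

(** The composite [g \o s] is a morphism although [s] is only a choice of
    preimages, because [g] identifies all the preimages of a point. *)
Lemma rmorph_factor (R : nzRingType) (K L : nzRingType)
    (f : {rmorphism R -> K}) (g : {rmorphism R -> L}) (s : K -> R) :
  cancel s f -> (forall r, f r = 0 -> g r = 0) ->
  inhabited {rmorphism K -> L}.
Proof.
move=> sK kfg; pose h x := g (s x).
have gE r t : f r = f t -> g r = g t.
  by move=> rt; apply/subr0_eq; rewrite -rmorphB kfg // rmorphB rt subrr.
have hB : zmod_morphism h.
  by move=> x y; rewrite /h -rmorphB; apply: gE; rewrite rmorphB !sK.
have hM : monoid_morphism h.
  split; first by rewrite /h -(rmorph1 g); apply: gE; rewrite rmorph1 sK.
  by move=> x y; rewrite /h -rmorphM; apply: gE; rewrite rmorphM !sK.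
pose hA := GRing.isZmodMorphism.Build K L h hB.
pose hX := GRing.isMonoidMorphism.Build K L h hM.
by constructor; exact: (HB.pack_for {rmorphism K -> L} h hA hX).
Qed.

Lemma finField_generator (K : finFieldType) :
  exists a : K, forall x, x != 0 -> exists i, x = a ^+ i.
Proof.
have /cyclicP[u defK] := field_unit_group_cyclic [group of [set: {unit K}]].
exists (val u) => x x0.
have: finField_unit x0 \in <[u]>%g by rewrite -defK inE.
case/cycleP => i /(congr1 val) /= ->; exists i.
by rewrite FinRing.val_unitX.
Qed.

(** The morphism [int -> K] factors through [int -> 'F_p]. *)
Lemma Fp_rmorph p (K : nzRingType) : p \in [pchar K] ->
  inhabited {rmorphism 'F_p -> K}.
Proof.
move=> chK; have p_pr := pcharf_prime chK.
apply: (@rmorph_factor _ _ _ (intr : {rmorphism int -> 'F_p})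
          (intr : {rmorphism int -> K}) (fun x : 'F_p => (x : nat)%:Z)).
  by move=> x; apply: natr_Zp.
move=> z /eqP; rewrite /= -(dvdz_pcharf (pchar_Fp p_pr)).
by rewrite (dvdz_pcharf chK) => /eqP.
Qed.

Section FiniteFieldIso.
Variables (p : nat) (K L : finFieldType).
Variables (i_K : {rmorphism 'F_p -> K}) (i_L : {rmorphism 'F_p -> L}).
Hypothesis cardKL : #|K| = #|L|.

Let ev_K (a : K) : {rmorphism {poly 'F_p} -> K} :=
  horner_morph (fun x => mulrC a (i_K x)).
Let ev_L (b : L) : {rmorphism {poly 'F_p} -> L} :=
  horner_morph (fun x => mulrC b (i_L x)).

(** A nonzero polynomial of least degree that kills a generator [a] of [K^*]
    generates the ideal of all polynomials killing [a]; it divides [X^q - X],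
    all elements of [L] are roots of the latter, and by counting one of them
    is a root [b] of the former. Hence [a |-> b] extends to a morphism. *)
Lemma finField_rmorph : inhabited {rmorphism K -> L}.
Proof.
have [a genK] := finField_generator K.
pose Q : {poly 'F_p} := 'X^#|K| - 'X.
have evKX : ev_K a 'X = a by rewrite /ev_K /= horner_morphX.
have evLX b : ev_L b 'X = b by rewrite /ev_L /= horner_morphX.
have QK : ev_K a Q = 0 by rewrite rmorphB rmorphXn /= evKX expf_card subrr.
have QL b : ev_L b Q = 0.
  by rewrite rmorphB rmorphXn /= evLX cardKL expf_card subrr.
have Q0 : Q != 0.
  rewrite -size_poly_eq0 size_polyDl ?size_polyXn // size_polyN size_polyX.
  by rewrite ltnS finNzRing_gt1.
(* Row vectors of length [d] stand for the polynomials of size at most [d], so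
   that the existence of a suitable polynomial of given size is decidable. *)
have exm : exists d, [exists m : 'rV['F_p]_d,
    (rVpoly m != 0) && (ev_K a (rVpoly m) == 0)].
  exists (size Q); apply/existsP; exists (poly_rV Q).
  by rewrite poly_rV_K // Q0 QK eqxx.
have [d /existsP[mr /andP[]]] := ex_minnP exm.
set m := rVpoly mr => m0 /eqP mK min_d.
have szm : (size m <= d)%N by apply: size_poly.
have kerm P : ev_K a P = 0 -> m %| P.
  move=> PK; rewrite /dvdp; apply/negPn/negP => r0.
  have rK : ev_K a (P %% m) = 0.
    by have := PK; rewrite {1}(divp_eq P m) rmorphD rmorphM mK mulr0 add0r.
  have : (d <= size (P %% m)%R)%N.
    apply: min_d; apply/existsP; exists (poly_rV (P %% m)).
    by rewrite poly_rV_K // r0 rK eqxx.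
  by rewrite leqNgt (leq_trans _ szm) // ltn_modp.
have /dvdpP[m' defQ] := kerm Q QK.
have [b mb] : exists b, ev_L b m = 0.
  have m'0 : m' != 0 by apply: contraNneq Q0 => m'0; rewrite defQ m'0 mul0r.
  have evLE (b : L) P : ev_L b P = (map_poly i_L P).[b] by [].
  case: (pickP (fun b => ev_L b m == 0)) => [b /eqP | no_root].
    by exists b.
  (* Otherwise the cofactor [m'], whose degree is less than [q] as [m] is not
     constant, would have all the [q] elements of [L] as roots. *)
  have roots_m' : all (root (map_poly i_L m')) (enum L).
    apply/allP => b _; apply/rootP; rewrite -evLE.
    by have /eqP := QL b; rewrite defQ rmorphM mulf_eq0 no_root orbF => /eqP.
  have := max_poly_roots _ roots_m' (enum_uniq L).
  rewrite map_poly_eq0 => /(_ m'0); rewrite size_map_poly -cardE -cardKL.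
  have := congr1 (fun P : {poly _} => size P) defQ.
  rewrite size_mul // size_polyDl ?size_polyXn; last first.
    by rewrite size_polyN size_polyX ltnS finNzRing_gt1.
  have : size m != 1%N.
    apply/negP => /size_poly1P[c c0 mc].
    move: mK; rewrite mc /ev_K /= horner_morphC => /eqP.
    by rewrite fmorph_eq0 (negPf c0).
  move: m0; rewrite -size_poly_eq0.
  by move: (size m) (size m') #|K| => s s' k *; exfalso; lia.
have sP x : {P | ev_K a P == x}.
  apply: sigW; have [-> | /genK[i ->]] := eqVneq x 0.
    by exists 0; rewrite rmorph0.
  by exists 'X^i; rewrite rmorphXn /= evKX.
apply: (@rmorph_factor _ _ _ (ev_K a) (ev_L b) (fun x => sval (sP x))).
  by move=> x; apply/eqP; exact: (svalP (sP x)).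
move=> P /kerm; case/dvdpP => P' ->.
by rewrite rmorphM mb mulr0.
Qed.
End FiniteFieldIso.

Lemma finField_iso p m (K L : finFieldType) : prime p ->
  #|K| = (p ^ m)%N -> #|L| = (p ^ m)%N -> inhabited {rmorphism K -> L}.
Proof.
move=> p_pr cK cL; have [iK] := Fp_rmorph (card_finPcharP cK p_pr).
have [iL] := Fp_rmorph (card_finPcharP cL p_pr).
by apply: finField_rmorph iK iL _; rewrite cK.
Qed.

(** * Symplectic bases *)

(** The Gram matrix of a symplectic basis, ordered by hyperbolic pairs. Its
    entries are integers, so that it is preserved by every ring morphism; the
    size [k.*2] makes the successor case convertible to a block matrix. *)
Fixpoint standard_symplectic_mx (R : pzRingType) k : 'M[R]_(k.*2) :=
  match k with
  | 0 => 0
  | k'.+1 => block_mx (block_mx 0 1%:M (- 1%:M) 0 : 'M_(1 + 1)) 0 0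
                      (standard_symplectic_mx R k') : 'M_(2 + k'.*2)
  end.

Lemma standard_symplectic_unitmx (F : fieldType) k :
  standard_symplectic_mx F k \in unitmx.
Proof.
elim: k => [|k IHk] /=; first by rewrite unitmxE det_mx00 unitr1.
rewrite unitmxE (@det_lblock _ 2 k.*2) unitrM -!unitmxE IHk andbT.
suff /mulmx1_unit[] : block_mx 0 1%:M (- 1%:M) 0 *m block_mx 0 (- 1%:M) 1%:M 0
  = 1%:M :> 'M[F]_(1 + 1) by [].
rewrite mulmx_block !mulmx0 !mul0mx mulmx1 mulmxN mulNmx mulmx1 !addr0 !add0r.
by rewrite opprK -scalar_mx_block.
Qed.

Lemma map_standard_symplectic_mx (R S : pzRingType) (f : {rmorphism R -> S}) k :
  map_mx f (standard_symplectic_mx R k) = standard_symplectic_mx S k.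
Proof.
elim: k => [|k IHk] /=; first by rewrite map_mx0.
rewrite (map_block_mx f (block_mx 0 1%:M (- 1%:M) 0 : 'M_(1 + 1)) 0 0
  (standard_symplectic_mx R k)) (map_block_mx f 0 1%:M (- 1%:M) 0).
by rewrite !map_mx0 map_mxN map_mx1 IHk.
Qed.

(** A hyperbolic pair in the orthogonal of a symplectic frame [A] extends it:
    the first vector exists by dimension, and the second one, which exists by
    nondegeneracy, can be moved into the orthogonal of [A] by subtracting its
    projection onto the row space of [A]. *)
Lemma symplectic_frame (F : fieldType) d (M : 'M[F]_d) k :
  alternating_mx M -> M \in unitmx -> (k.*2 <= d)%N ->
  exists A : 'M_(k.*2, d), A *m M *m A^T = standard_symplectic_mx F k.
Proof.
move=> altM uM; elim: k => [|k IHk] kd.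
  by exists 0; apply: (etrans (flatmx0 _) (esym (flatmx0 _))).
have [|A AJ] := IHk; first by apply: leq_trans kd; rewrite doubleS ltnW.
set J := standard_symplectic_mx F k in AJ.
have uJ : J \in unitmx by apply: standard_symplectic_unitmx.
have [w /sub_kermxP wA w0] :
    exists2 w : 'rV_d, (w <= kermx (M *m A^T))%MS & w != 0.
  apply/rowV0Pn; rewrite -mxrank_eq0 mxrank_ker subn_eq0 -ltnNge.
  by apply: leq_ltn_trans (rank_leq_col _) _; apply: leq_trans kd.
have [u0 wu0] : exists u0 : 'rV_d, w *m M *m u0^T = 1%:M.
  have /rV0Pn[j wj] : w *m M != 0.
    by apply: contraNneq w0 => wM; rewrite -(mulmxK uM w) wM mul0mx.
  exists (((w *m M) 0 j)^-1 *: delta_mx 0 j).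
  rewrite linearZ /= -scalemxAr trmx_delta -colE [col _ _]mx11_scalar.
  by rewrite [col _ _ _ _]mxE scale_scalar_mx mulVf.
(* The coordinates of the projection of [u0] on [A] are [u0 M A^T J^-1]. *)
pose u := u0 - u0 *m M *m A^T *m invmx J *m A.
have uA : u *m M *m A^T = 0.
  rewrite !mulmxBl -!(mulmxA (_ *m invmx J)) AJ.
  by rewrite mulmxKV ?subrr.
have wAE : w *m M *m A^T = 0 by rewrite -mulmxA.
have wu : w *m M *m u^T = 1%:M.
  by rewrite linearB /= mulmxBr wu0 trmx_mul mulmxA wAE mul0mx subr0.
have uw : u *m M *m w^T = - 1%:M.
  have -> : u *m M *m w^T = (w *m M^T *m u^T)^T.
    by rewrite !trmx_mul !trmxK mulmxA.
  by rewrite (alternating_mx_skew altM) mulmxN mulNmx wu linearN /= trmx1.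
have Aorth v : v *m M *m A^T = 0 -> A *m M *m v^T = 0.
  by move=> /eqP vA; apply/eqP; rewrite alternating_mx_orthC.
have block_gram (X : 'M_(1 + 1, d)) : X *m M *m A^T = 0 ->
    col_mx X A *m M *m (col_mx X A)^T = block_mx (X *m M *m X^T) 0 0 J.
  by move=> XA; rewrite mul_col_mx tr_col_mx mul_col_row XA AJ Aorth.
exists (col_mx (col_mx w u) A); rewrite [LHS]block_gram /=.
  rewrite mul_col_mx tr_col_mx mul_col_row.
  by rewrite !altM wu uw.
by rewrite !mul_col_mx uA wAE col_mx0.
Qed.

(** Matching symplectic bases of the two spaces, and applying the field
    morphism to coordinates, gives a semilinear isometry. *)
Lemma semilinear_isometry (F E : finFieldType) (f : {rmorphism F -> E}) n
    (B : {biscalar 'rV[F]_(2 * n)}) (B' : {biscalar 'rV[E]_(2 * n)}) :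
  alternating_form B -> nondegenerate_form B ->
  alternating_form B' -> nondegenerate_form B' ->
  exists phi : 'rV[F]_(2 * n) -> 'rV[E]_(2 * n),
    [/\ {morph phi : u v / u + v}, injective phi
      & forall u v, B' (phi u) (phi v) = f (B u v)].
Proof.
move=> altB ndB altB' ndB'.
have n2 : (n.*2 <= 2 * n)%N by rewrite mul2n.
have [A AJ] := symplectic_frame (alternating_mx_of_form altB)
  (nondegenerate_unitmx ndB) n2.
have [A' AJ'] := symplectic_frame (alternating_mx_of_form altB')
  (nondegenerate_unitmx ndB') n2.
have frame_free (K : fieldType) (N : 'M[K]_(2 * n)) (X : 'M_(n.*2, 2 * n)) :
    X *m N *m X^T = standard_symplectic_mx K n -> row_free X.
  move=> XJ; rewrite /row_free eqn_leq rank_leq_row.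
  have /mxrank_unit {1}<- := standard_symplectic_unitmx K n.
  by rewrite -XJ -mulmxA mxrankM_maxl.
have full_A : row_full A by rewrite /row_full (eqP (frame_free _ _ _ AJ)) mul2n.
have AK (u : 'rV_(2 * n)) : u *m pinvmx A *m A = u.
  by rewrite mulmxKpV // submx_full.
pose phi (u : 'rV_(2 * n)) := map_mx f (u *m pinvmx A) *m A'.
exists phi; split.
- by move=> u v; rewrite /phi mulmxDl map_mxD mulmxDl.
- move=> u v /(row_free_inj (frame_free _ _ _ AJ'))/map_mx_inj uv.
  by rewrite -(AK u) uv AK.
- move=> u v; rewrite !biscalar_mxE /phi -{2}(AK u) -{2}(AK v).
  set x := u *m pinvmx A; set y := v *m pinvmx A.
  have gram (K : fieldType) (N : 'M[K]_(2 * n)) (X : 'M_(n.*2, 2 * n)) r s :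
      r *m X *m N *m (s *m X)^T = r *m (X *m N *m X^T) *m s^T :> 'M_1.
    by rewrite trmx_mul !mulmxA.
  rewrite !gram AJ AJ' -(map_standard_symplectic_mx f) map_trmx -!map_mxM.
  by rewrite mxE.
Qed.

(** * Isoclinism of groups of Heisenberg type *)

(** The maps [c] and [c'] are additive coordinates on the groups, and [h] is [g]
    read in these coordinates; both halves of an isoclinism arise this way. *)
Lemma transported_isomorphism (aT bT : finGroupType)
    (D : {group aT}) (D' : {group bT})
    (U : zmodType) (V : finZmodType) (c : aT -> U) (c' : bT -> V) (g : U -> V) :
  {in D &, {morph c : x y / (x * y)%g >-> x + y}} -> {in D &, injective c} ->
  {in D' &, {morph c' : x y / (x * y)%g >-> x + y}} ->
  {in D' &, injective c'} ->
  c' @: D' = [set: V] -> {morph g : u v / u + v} -> injective g ->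
  #|D| = #|D'| ->
  exists h : {morphism D >-> bT},
    isom D D' h /\ {in D, forall a, c' (h a) = g (c a)}.
Proof.
move=> cM cI c'M c'I c'S gD gI cardD.
have [s sP] : exists s : V -> bT, forall v, s v \in D' /\ c' (s v) = v.
  apply: (@fin_all_exists _ (fun=> bT) (fun v b => b \in D' /\ c' b = v)) => v.
  have : v \in c' @: D' by rewrite c'S inE.
  by case/imsetP => b Db ->; exists b.
have sD v : s v \in D' := (sP v).1.
have c's v : c' (s v) = v := (sP v).2.
pose h a := s (g (c a)).
have hM : {in D &, {morph h : x y / (x * y)%g}}.
  move=> x y Dx Dy; apply: c'I; rewrite ?groupM ?sD //.
  by rewrite c'M ?sD // !c's cM // gD.
exists (Morphism hM); split; last by move=> a _; apply: c's.
have injh : ('injm (Morphism hM))%g.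
  apply/injmP => x y Dx Dy /= /(congr1 c'); rewrite !c's => /gI.
  exact: cI.
apply/isomP; split=> //; apply/eqP.
rewrite eqEcard card_injm // cardD leqnn andbT.
by apply/subsetP => b /morphimP[a _ _ ->]; apply: sD.
Qed.

Lemma heisenberg_isoclinic (F E : finFieldType) (n : nat) (gT hT : finGroupType)
    (G : {group gT}) (H : {group hT})
    (S : heisenberg_structure F n G) (T : heisenberg_structure E n H)
    (f : {rmorphism F -> E}) : #|F| = #|E| -> isoclinic G H.
Proof.
move=> cardFE.
have [g [gD gI gB]] := semilinear_isometry f (@hs_alternating _ _ _ _ S)
  (@hs_nondegenerate _ _ _ _ S) (@hs_alternating _ _ _ _ T)
  (@hs_nondegenerate _ _ _ _ T).
have [|phi [isoV phiE]] := transported_isomorphism (@hs_coordM _ _ _ _ S)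
  (@hs_coord_inj _ _ _ _ S) (@hs_coordM _ _ _ _ T) (@hs_coord_inj _ _ _ _ T)
  (hs_coord_surj T) gD gI.
  by rewrite (card_heisenberg_quotient S) (card_heisenberg_quotient T) cardFE.
have [|psi [isoC psiE]] := transported_isomorphism (@hs_commM _ _ _ _ S)
  (@hs_comm_inj _ _ _ _ S) (@hs_commM _ _ _ _ T) (@hs_comm_inj _ _ _ _ T)
  (hs_comm_surj T) (rmorphD f) (fmorph_inj f).
  by rewrite (card_heisenberg_derived S) (card_heisenberg_derived T).
exists phi, psi; split=> // a b Ga Gb.
have commG (kT : finGroupType) (K : {group kT}) x y :
    x \in (K / 'Z(K))%g -> y \in (K / 'Z(K))%g -> comm_map x y \in (K^`(1))%g.
  move=> /morphimP[u _ Ku ->] /morphimP[v _ Kv ->]; rewrite comm_mapE //.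
  exact: mem_commg.
have phiH x : x \in (G / 'Z(G))%g -> phi x \in (H / 'Z(H))%g.
  by move=> Gx; have [_ <-] := isomP isoV; apply: mem_morphim.
have psiH x : x \in (G^`(1))%g -> psi x \in (H^`(1))%g.
  by move=> Gx; have [_ <-] := isomP isoC; apply: mem_morphim.
apply: (@hs_comm_inj _ _ _ _ T); rewrite ?psiH ?commG ?phiH //.
by rewrite psiE ?commG // -!hs_formE ?phiH // !phiE // gB.
Qed.

Lemma isoclinic_cards (gT hT : finGroupType) (G : {group gT}) (H : {group hT}) :
  isoclinic G H -> #|(G / 'Z(G))%g| = #|(H / 'Z(H))%g| /\
                   #|(G^`(1))%g| = #|(H^`(1))%g|.
Proof. by case=> phi [psi [/isom_card-> /isom_card-> _]]. Qed.

(** A group of rank [0] would equal its center and be abelian. *)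
Lemma heisenberg_rank_gt0 p q n (gT : finGroupType) (G : {group gT}) :
  heisenberg_type p q n G -> (0 < n)%N.
Proof.
case=> _ [cl2 _] _ _ [F [_ [S]]]; rewrite lt0n; apply/eqP => n0.
suff : abelian G by rewrite -nil_class1 cl2.
have := card_heisenberg_center S; rewrite n0 muln0 muln1 => cG.
by apply/center_idP/eqP; rewrite eqEcard center_sub cG leqnn.
Qed.

(** * The theorem *)

Theorem theorem7p14 (R : realFieldType) (C : numClosedFieldType)
    (p m q n m' q' n' : nat) (gT hT : finGroupType)
    (G : {group gT}) (H : {group hT})
    (p_prime : prime p) (p_odd : odd p)
    (m_ge1 : (1 <= m)%N) (qE : q = (p ^ m)%N)
    (m'_ge1 : (1 <= m')%N) (q'E : q' = (p ^ m')%N)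
    (hG : heisenberg_type p q n G) (hH : heisenberg_type p q' n' H) :
  (forall (F : finFieldType) (S : heisenberg_structure F n G), #|F| = q ->
    let L k := #|isotropic_subspaces (hs_form S) k| in
    (forall k : nat, (k <= n)%N ->
      (L k)%:R = \prod_(i < k)
        ((q%:R ^+ (2 * n - 2 * i) - 1) / (q%:R ^+ (k - i) - 1)) :> rat)
    /\
    (forall r : nat, (1 <= r)%N ->
      [/\ forall (E : finFieldType) (B : {biscalar 'rV[E]_(2 * n)}),
            #|E| = q -> alternating_form B -> nondegenerate_form B ->
            #|isotropic_tuples B r|%:R =
              \sum_(k < (minn n r).+1)
                (L k)%:R * \prod_(i < k) (q%:R ^+ r - q%:R ^+ i) :> rat,
          #|comm_tuples G r|%:R =
            #|'Z(G)%g|%:R ^+ r *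
            \sum_(k < (minn n r).+1)
              (L k)%:R * \prod_(i < k) (q%:R ^+ r - q%:R ^+ i) :> rat
        & comm_prob G r =
            q%:R ^- (2 * n * r) *
            \sum_(k < (minn n r).+1)
              (L k)%:R * \prod_(i < k) (q%:R ^+ r - q%:R ^+ i)]))
  /\
  (forall (kT : finGroupType) (K : {group kT}), heisenberg_type p q n K ->
    forall r : nat, (2 <= r)%N -> comm_prob K r = comm_prob G r)
  /\
  [<-> isoclinic G H;
       (q, n) = (q', n');
       comm_prob G 2 = comm_prob H 2 /\ comm_prob G 3 = comm_prob H 3;
       forall r : nat, (2 <= r)%N -> comm_prob G r = comm_prob H r]
  /\
  (forall x : R, 0 < x ->
    (ratr (comm_prob G 2 - comm_prob G 3) * x ^+ 2
      + ratr (comm_prob G 2 - 1) * x + ratr (comm_prob G 2 - 1) = 0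
     <-> x = q%:R))
  /\
  q%:R ^- (2 * n) = (q%:R * comm_prob G 2 - 1) / (q%:R - 1)
  /\
  (let P := fun s : nat => comm_prob G s.+2 in
    [/\ rational_series P,
        forall z : C, series_pole P z ->
          exists2 j : nat, (n <= j <= 2 * n)%N & z = q%:R ^+ j
      & series_pole P (q%:R ^+ n : C)]).
Proof.
have q1 : (1 < q)%N by rewrite qE -(expn0 p) ltn_exp2l // prime_gt1.
have q1' : (1 < q')%N by rewrite q'E -(expn0 p) ltn_exp2l // prime_gt1.
have n0 := heisenberg_rank_gt0 hG; have n0' := heisenberg_rank_gt0 hH.
have [_ _ _ _ [F [cardF [S]]]] := hG; have [_ _ _ _ [E [cardE [T]]]] := hH.
have probG r : comm_prob G r = heisenberg_prob q n r.
  by rewrite (comm_probE S) cardF.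
have probH r : comm_prob H r = heisenberg_prob q' n' r.
  by rewrite (comm_probE T) cardE.
split; [|split; [|split; [|split; [|split]]]].
- move=> {cardF}F0 S0 cardF0 L.
  have LE k : (L k)%:R = isotropic_subspace_count q n k :> rat.
    rewrite /L card_isotropic_subspacesE ?cardF0 //.
      exact: hs_alternating.
    exact: hs_nondegenerate.
  have sumE r : \sum_(k < (minn n r).+1)
      (L k)%:R * \prod_(i < k) (q%:R ^+ r - q%:R ^+ i) = isotropic_count q n r.
    by apply: eq_bigr => k _; rewrite LE.
  split=> [k _ | r _]; first exact: LE.
  rewrite sumE; split; last exact: probG.
    by move=> K B cardK altB ndB; rewrite card_isotropic_tuplesE // cardK.
  by rewrite (card_comm_tuplesE S0) cardF0.
- move=> kT K [_ _ _ _ [F0 [cardF0 [S0]]]] r _.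
  by rewrite probG (comm_probE S0) cardF0.
- tfae.
  + case/isoclinic_cards; rewrite (card_heisenberg_quotient S).
    rewrite (card_heisenberg_quotient T) (card_heisenberg_derived S).
    rewrite (card_heisenberg_derived T) cardF cardE => + eq_q; rewrite -eq_q.
    by move/eqP; rewrite eqn_exp2l // eqn_pmul2l // => /eqP ->.
  + by case=> eq_q eq_n; rewrite !probG !probH eq_q eq_n.
  + rewrite !probG !probH => -[e2 e3] r _.
    have [eq_q eq_n] := heisenberg_prob_inj q1 n0 q1' n0' e2 e3.
    by rewrite probG probH eq_q eq_n.
  + move=> eqP_r; have := eqP_r 2 isT; have := eqP_r 3 isT.
    rewrite !probG !probH => e3 e2.
    have [eq_q eq_n] := heisenberg_prob_inj q1 n0 q1' n0' e2 e3.
    move: T; rewrite -eq_n => T.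
    have [f] : inhabited {rmorphism F -> E}.
      by apply: (@finField_iso p m); rewrite // ?cardF ?cardE -?eq_q qE.
    by apply: heisenberg_isoclinic S T f _; rewrite cardF cardE.
- by move=> x x0; rewrite !probG; apply: heisenberg_quadratic.
- by rewrite probG; apply: heisenberg_rank.
- have poleG (z : C) : series_pole (fun s => comm_prob G s.+2) z <->
      series_pole (fun s => heisenberg_prob q n s.+2) z.
    split=> -[N [D [[D0 sD] cop rt]]]; exists N, D; split=> //; split=> // k;
      rewrite -sD; by apply: eq_bigr => i _; rewrite probG.
  split.
  + have [N [D [D0 sD]]] := heisenberg_series_rational n q1.
    exists N, D; split=> // k; rewrite -sD.
    by apply: eq_bigr => i _; rewrite probG.
  + by move=> z /poleG; apply: heisenberg_series_pole.
  + exact/poleG/heisenberg_series_pole_rank.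
Qed.
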